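(* Let $F\in\mathcal{L}_1$ be non-decreasing and have a constant section $K$. Assume that there exists $n\in\mathbb{N}$ such that $F^n(K)\cap(K+\mathbb{Z})\neq\emptyset$, and that $n$ is minimal with this property. Then there exists $\xi\in\mathbb{R}$ such that $F^n(K)=\{\xi\}\subset K+m$ with $m=\lfloor \xi-\min K\rfloor\in\mathbb{Z}$, $\xi$ is an $n$-periodic (mod $1$) point of $F$, and $\rho_F=\frac{m}{n}$.
   Context: $\mathbb{N}$ denotes the positive integers and $\lfloor\cdot\rfloor$ the floor function. $\mathbb{S}^1$ is the unit circle in $\mathbb{C}$ and $e:\mathbb{R}\to\mathbb{S}^1$ is $e(x)=\exp(2\pi i x)$. A lifting of a continuous map $f:\mathbb{S}^1\to\mathbb{S}^1$ is a continuous map $F:\mathbb{R}\to\mathbb{R}$ with $e(F(x))=f(e(x))$ for every $x\in\mathbb{R}$. $\mathcal{L}_1$ is the set of all liftings of continuous circle maps of degree $1$, i.e. the set of all continuous $F:\mathbb{R}\to\mathbb{R}$ with $F(x+1)=F(x)+1$ for every $x\in\mathbb{R}$. $F^n$ denotes the $n$-th iterate of $F$. A constant section of $F$ is a closed bounded non-degenerate (i.e. with non-empty interior) interval $K\subset\mathbb{R}$ such that $F|_K$ is constant (for $F\in\mathcal{L}_1$ the length of $K$ is then automatically less than $1$). For $A\subset\mathbb{R}$ and $m\in\mathbb{Z}$, $A+m:=\{x+m : x\in A\}$ and $A+\mathbb{Z}:=\{x+m : x\in A,\ m\in\mathbb{Z}\}$. For $F$ a lifting of $f$, a point $x\in\mathbb{R}$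 is an $n$-periodic (mod $1$) point of $F$ if $e(x)$ is a periodic point of $f$ of (least) period $n$, i.e. $f^n(e(x))=e(x)$ and $f^k(e(x))\neq e(x)$ for $1\le k<n$; for $F\in\mathcal{L}_1$ this is equivalent to $F^n(x)-x\in\mathbb{Z}$ and $F^j(x)-x\notin\mathbb{Z}$ for $j=1,\dots,n-1$. For a non-decreasing $F\in\mathcal{L}_1$, the limit $\lim_{k\to\infty}\frac{F^k(x)-x}{k}$ exists for every $x\in\mathbb{R}$ and is independent of $x$; it is called the rotation number of $F$ and denoted $\rho_F$. *)

(* Defs.v *)
From HB Require Import structures.
From mathcomp Require Import all_boot all_order all_algebra.
From mathcomp Require Import complex.
From mathcomp Require Import all_classical all_reals all_analysis.

Set Implicit Arguments.
Unset Strict Implicit.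
Unset Printing Implicit Defensive.

Import Order.TTheory GRing.Theory Num.Theory numFieldNormedType.Exports.

Local Open Scope classical_set_scope.
Local Open Scope ring_scope.
Local Open Scope complex_scope.

Section CircleMaps.
Context {R : realType}.
Implicit Types (A : set R) (F : R -> R) (f : R[i] -> R[i]).

Definition circle : set R[i] := [set z | `|z| = 1].

(* exp(2 pi i x), in Cartesian form *)
Definition circle_exp (x : R) : R[i] :=
  (cos (2 * pi * x) +i* sin (2 * pi * x))%C.

(* Circle maps are total functions on the complex numbers whose values outside
   [circle] are irrelevant; [R[i]^o] carries the topology of the modulus. *)
Definition circle_map f : Prop :=
  set_fun circle circle f /\
  {within (circle : set R[i]^o), continuous (f : R[i]^o -> R[i]^o)}.

Definition lifting F f : Prop :=
  continuous F /\ forall x, circle_exp (F x) = f (circle_exp x).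

Definition L1 : set (R -> R) :=
  [set F : R -> R | continuous F /\ forall x, F (x + 1) = F x + 1].

Definition constant_section F (K : set R) : Prop :=
  (exists a b : R, a < b /\ K = `[a, b]%classic) /\
  exists c, forall x, K x -> F x = c.

Definition translate A (m : int) : set R := [set x + m%:~R | x in A].

Definition translateZ A : set R := \bigcup_(m in [set: int]) translate A m.

Definition periodic_point f (n : nat) (z : R[i]) : Prop :=
  [/\ (0 < n)%N, iter n f z = z &
      forall k : nat, (0 < k < n)%N -> iter k f z <> z].

(* The circle map [f] lifted by [F] is unique on [circle]. *)
Definition periodic_point_mod1 F (n : nat) (x : R) : Prop :=
  exists f, [/\ circle_map f, lifting F f & periodic_point f n (circle_exp x)].

(* [rho] is the common limit, over all starting points, so the convergence
   itself is part of the predicate. *)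
Definition is_rotation_number F (rho : R) : Prop :=
  forall x : R, (iter k F x - x) / k%:R @[k --> \oo] --> rho.

Definition meets_translates F (K : set R) (n : nat) : Prop :=
  (iter n F @` K) `&` translateZ K !=set0.

End CircleMaps.

(* Main.v *)
Require Import Defs.
From HB Require Import structures.
From mathcomp Require Import all_boot all_order all_algebra.
From mathcomp Require Import complex.
From mathcomp Require Import all_classical all_reals all_analysis.
From mathcomp Require Import ring lra.

(** Only the point of [K] that returns to [K + Z] matters.  Since [F] is
    constant on [K], so is every iterate [F^k] with [k > 0]; hence if one point
    of [F^n(K)] lies in [K + m], all of [F^n(K)] is that single point
    [xi = y + m], with [y] in [K].  The iterates commute with integer
    translations, so [F^n(xi) = F^n(y) + m = xi + m].  An earlier return
    [F^k(xi) = xi + l], with [0 < k < n], would give [F^k(y)] in [K + Z],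
    against the minimality of [n].  Finally [K] is shorter than 1, because
    [F(x + 1) = F(x) + 1] separates the values at points a unit apart, and this
    identifies [m] as the floor of [xi - min K].

    Two transfers remain.  Least periods are those of the circle map below [F]:
    [L1_lifting] produces this map and proves its continuity, using that
    [circle_exp] maps a compact interval onto the circle, and
    [circle_exp_eq] turns equalities on the circle into equalities modulo
    integers.  For the rotation number, [F^k(xi) - xi - k * m / n] is
    [n]-periodic in [k], hence bounded, and by monotonicity the displacement of
    any other point under [F^k] differs from that of [xi] by at most 1
    ([L1_drift_bound]); dividing by [k] gives the limit [m / n]. *)

Set Implicit Arguments.
Unset Strict Implicit.
Unset Printing Implicit Defensive.

Import Order.TTheory GRing.Theory Num.Theory numFieldNormedType.Exports.
Local Open Scope classical_set_scope.
Local Open Scope ring_scope.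

(** * The exponential covering of the circle *)

Lemma cosD2pi_nat (R : realType) (x : R) (k : nat) :
  cos (x + 2 * pi * k%:R) = cos x.
Proof.
elim: k => [|k IH]; first by rewrite mulr0 addr0.
by rewrite -[k.+1%:R]natr1 mulrDr mulr1 addrA [2 * pi]mulr_natl cosD2pi
  -[pi *+ 2]mulr_natl.
Qed.

Lemma sinD2pi_nat (R : realType) (x : R) (k : nat) :
  sin (x + 2 * pi * k%:R) = sin x.
Proof.
elim: k => [|k IH]; first by rewrite mulr0 addr0.
by rewrite -[k.+1%:R]natr1 mulrDr mulr1 addrA [2 * pi]mulr_natl sinD2pi
  -[pi *+ 2]mulr_natl.
Qed.

Lemma circle_expDz (R : realType) (x : R) (m : int) :
  circle_exp (x + m%:~R) = circle_exp x.
Proof.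
have natE (y : R) k : circle_exp (y + k%:R) = circle_exp y.
  by rewrite /circle_exp mulrDr cosD2pi_nat sinD2pi_nat.
case: m => k; first exact: natE.
by rewrite -[LHS](natE _ k.+1) NegzE mulrNz -addrA addNr addr0.
Qed.

(** The fibres of [circle_exp] are the cosets of the integers: the fractional
    part [d] of [x - y] has [cos (2 pi d) = 1], so [sin (pi d) = 0], while the
    sine is positive on the open interval from 0 to [pi]. *)
Lemma circle_exp_eq (R : realType) (x y : R) :
  circle_exp x = circle_exp y -> exists m : int, x = y + m%:~R.
Proof.
rewrite /circle_exp => -[ecos esin].
exists (Num.floor (x - y)); set m := Num.floor _.
pose d := x - y - m%:~R.
have /andP[mle ltm] := floor_itv (x - y).
have d_ge0 : 0 <= d by rewrite subr_ge0.
have d_lt1 : d < 1 by move: ltm; rewrite /d intrD; lra.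
have cosd : cos (2 * pi * d) = 1.
  have -> : cos (2 * pi * d) = cos (2 * pi * (x - y)).
    have := circle_expDz (x - y) (- m).
    by rewrite /circle_exp mulrNz => -[-> _].
  by rewrite mulrBr cosB ecos esin -!expr2 cos2Dsin2.
have sind : sin (pi * d) = 0.
  have := cosd; rewrite (_ : 2 * pi * d = pi * d + pi * d); last by ring.
  rewrite cosD -!expr2 => cosd1; have := cos2Dsin2 (pi * d) => cs.
  by apply/eqP; rewrite -sqrf_eq0; apply/eqP; lra.
suff : d = 0 by rewrite /d; lra.
apply/eqP; rewrite eq_le d_ge0 andbT leNgt; apply/negP => d_gt0.
suff : 0 < sin (pi * d) by rewrite sind ltxx.
by apply: sin_gt0_pi; rewrite mulr_gt0 ?pi_gt0//= gtr_pMr ?pi_gt0.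
Qed.

Lemma circle_exp_circle (R : realType) (x : R) : circle (circle_exp x).
Proof. by rewrite /circle /= normc_def /= cos2Dsin2 sqrtr1. Qed.

(** A compact interval already covers the circle; this compactness is what makes
    the circle map below a lifting continuous. *)
Lemma circle_exp_surj (R : realType) (z : R[i]) : circle z ->
  exists2 x : R, x \in `[-1, 1] & circle_exp x = z.
Proof.
case: z => a b; rewrite /circle /= normc_def /= => -[/(congr1 (fun u => u ^+ 2))].
rewrite sqr_sqrtr ?addr_ge0 ?sqr_ge0// expr1n => ab1.
have a_itv : -1 <= a <= 1 by apply/andP; split; nra.
have pi0 : 0 < (pi : R) := pi_gt0 R.
have twopi0 : 2 * pi != 0 :> R by rewrite mulf_neq0 ?gt_eqF.
pose t := acos a / (2 * pi).
have t_itv : 0 <= t <= 1.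
  rewrite divr_ge0 ?acos_ge0 ?mulr_ge0 ?(ltW pi0)//=.
  rewrite /t ler_pdivrMr ?mulr_gt0// mul1r.
  by apply: le_trans (acos_lepi a_itv) _; lra.
have tE : 2 * pi * t = acos a by rewrite mulrC divfK.
have sE : sin (acos a) = `|b| by rewrite sin_acos// -sqrtr_sqr; congr Num.sqrt; lra.
have cE : cos (acos a) = a by rewrite acosK// in_itv.
have [b0|b0] := leP 0 b.
- exists t; first by rewrite in_itv /=; lra.
  by rewrite /circle_exp tE sE cE ger0_norm.
- exists (- t); first by rewrite in_itv /=; lra.
  by rewrite /circle_exp mulrN cosN sinN tE sE cE ltr0_norm// opprK.
Qed.

Lemma continuous_circle_exp (R : realType) :
  continuous (circle_exp : R -> (R[i]^o)%C).
Proof.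
(* a positive element of [R[i]] is real, so its imaginary part [e'] vanishes *)
move=> x; apply/cvgrPdist_lt => /= -[e e']; rewrite ltcE /= => /andP[/eqP-> e0].
have e20 : 0 < e / 2 by rewrite divr_gt0.
have cvl : (2 * pi * t) @[t --> x] --> 2 * pi * x by apply: cvgMr; exact: cvg_id.
have cc : cos (2 * pi * t) @[t --> x] --> cos (2 * pi * x).
  by apply: (cvg_comp _ _ cvl); exact: continuous_cos.
have cs : sin (2 * pi * t) @[t --> x] --> sin (2 * pi * x).
  by apply: (cvg_comp _ _ cvl); exact: continuous_sin.
move/cvgrPdist_lt : cc => /(_ _ e20) cc.
move/cvgrPdist_lt : cs => /(_ _ e20) cs.
have sq_lt (u : R) : `|u| < e / 2 -> u ^+ 2 < e ^+ 2 / 4.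
  move=> ue; rewrite -[u ^+ 2]real_normK ?num_real//.
  have -> : e ^+ 2 / 4 = (e / 2) ^+ 2 by field.
  by rewrite ltr_pXn2r// nnegrE ltW.
apply: filterS2 cc cs => t /sq_lt ct /sq_lt st.
rewrite normc_def /= ltcR -[e in X in _ < X]ger0_norm ?ltW// -sqrtr_sqr.
by rewrite ltr_sqrt ?exprn_gt0//; have := exprn_gt0 2 e0; lra.
Qed.

(** * Degree-one liftings and their circle maps *)

Lemma L1Dz (R : realType) (F : R -> R) (x : R) (m : int) :
  L1 F -> F (x + m%:~R) = F x + m%:~R.
Proof.
move=> [_ FD1].
have natE (y : R) k : F (y + k%:R) = F y + k%:R.
  elim: k => [|k IH]; first by rewrite !addr0.
  by rewrite -natr1 !addrA FD1 IH.
(* negative translations follow from positive ones applied at [x + m] *)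
case: m => k; first exact: natE.
apply: (@addIr _ k.+1%:R).
by rewrite -natE NegzE mulrNz -!addrA addNr !addr0.
Qed.

Lemma iter_L1Dz (R : realType) (F : R -> R) (k : nat) (x : R) (m : int) :
  L1 F -> iter k F (x + m%:~R) = iter k F x + m%:~R.
Proof. by move=> FL; elim: k => //= k ->; rewrite L1Dz. Qed.

(** The circle map is [F] read through an arbitrary choice of arguments, which
    is harmless because [F] commutes with integer translations.  It is continuous
    because [circle_exp] restricted to a compact interval is a quotient map onto
    the circle: the preimage of a closed set is the image of a compact set, hence
    closed in the Hausdorff complex plane. *)
Lemma L1_lifting (R : realType) (F : R -> R) :
  L1 F -> exists f, circle_map f /\ lifting F f.
Proof.
move=> FL; pose f z := circle_exp (F (xget 0 [set x | circle_exp x = z])).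
have fE x : f (circle_exp x) = circle_exp (F x).
  rewrite /f; case: xgetP => [y _ /circle_exp_eq[m ->]|/(_ x)/(_ erefl)//].
  by rewrite L1Dz// circle_expDz.
exists f; split; last by split => [|x]; [exact: FL.1 | rewrite fE].
split=> [z _|]; first exact: circle_exp_circle.
apply/continuous_closedP => C C_closed.
apply/closed_subspaceP.
pose D : set R := `[-1, 1] `&` (fun x => circle_exp (F x)) @^-1` C.
exists (@circle_exp R @` D).
  apply: (@compact_closed (R[i]^o)%C); first exact: norm_hausdorff.
  apply: (@continuous_compact R (R[i]^o)%C).
    by apply: continuous_subspaceT; exact: continuous_circle_exp.
  apply: compact_closedI; first exact: segment_compact.
  apply: (closed_comp (f := fun x : R => circle_exp (F x) : (R[i]^o)%C)) => //.
  move=> x _.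
  apply: (@continuous_comp R R (R[i]^o)%C F (@circle_exp R)).
    exact: FL.1.
  exact: continuous_circle_exp.
apply/seteqP; split=> z /=.
  move=> [[x [_ Cx] <-] zc]; split => //.
  by change (C (f (circle_exp x))); rewrite fE.
move=> [Cz zc]; split => //; change (C (f z)) in Cz.
have [x x_itv xz] := circle_exp_surj zc.
by exists x => //; split => //=; rewrite -fE xz.
Qed.

Lemma lifting_iter (R : realType) (F : R -> R) f (k : nat) (x : R) :
  lifting F f -> circle_exp (iter k F x) = iter k f (circle_exp x).
Proof. by move=> [_ Ff]; elim: k => //= k <-; rewrite Ff. Qed.

Lemma periodic_point_mod1_of_iter (R : realType) (F : R -> R) (n : nat) (x : R)
    (m : int) :
  L1 F -> (0 < n)%N -> iter n F x = x + m%:~R ->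
  (forall k (l : int), (0 < k < n)%N -> iter k F x <> x + l%:~R) ->
  periodic_point_mod1 F n x.
Proof.
move=> FL n0 Fnx Fkx; have [f [fc Ff]] := L1_lifting FL.
exists f; split => //; split => // [|k kn].
  by rewrite -(lifting_iter _ _ Ff) Fnx circle_expDz.
by rewrite -(lifting_iter _ _ Ff) => /circle_exp_eq[l]; exact: Fkx.
Qed.

(** * Rotation numbers *)

Lemma periodic_bounded (R : realType) (u : nat -> R) (n : nat) :
  (0 < n)%N -> (forall k, u (n + k)%N = u k) ->
  exists C : R, forall k, `|u k| <= C.
Proof.
move=> n0 un; exists (\sum_(r < n) `|u r|) => k.
have uq q r : u (q * n + r)%N = u r.
  by elim: q => [//|q IH]; rewrite mulSn -addnA un.
rewrite (divn_eq k n) uq (bigD1 (Ordinal (ltn_pmod k n0))) //= lerDl.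
by rewrite sumr_ge0.
Qed.

Lemma bounded_div_cvg0 (R : realType) (u : nat -> R) (C : R) :
  (forall k, `|u k| <= C) -> u k / k%:R @[k --> \oo] --> 0.
Proof.
move=> uC.
have inv0 : (k%:R^-1 : R) @[k --> \oo] --> 0.
  by rewrite -cvg_shiftS; exact: cvg_harmonic.
apply/norm_cvg0P.
have : C * k%:R^-1 @[k --> \oo] --> C * 0 by apply: cvgMr.
rewrite mulr0 => Ck.
apply: (squeeze_cvgr _ (cvg_cst 0) Ck).
near=> k.
by rewrite normr_ge0 normrM normfV normr_nat ler_wpM2r// invr_ge0.
Unshelve. all: by end_near.
Qed.

(** Up to an integer translation, [y <= x <= y + 1], and a non-decreasing map
    commuting with integer translations preserves these inequalities. *)
Lemma L1_drift_bound (R : realType) (F : R -> R) (k : nat) (x y : R) :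
  L1 F -> {homo F : x y / x <= y} ->
  `|(iter k F x - x) - (iter k F y - y)| <= 1.
Proof.
move=> FL Fnd.
have Fk : {homo iter k F : x y / x <= y}.
  by elim: k => [//|k IH] a b ab /=; apply: Fnd; exact: IH.
have /andP[] := floor_itv (x - y); set l := Num.floor _.
rewrite intrD => lx xl.
have h1 : iter k F y + l%:~R <= iter k F x.
  by rewrite -iter_L1Dz//; apply: Fk; lra.
have h2 : iter k F x <= iter k F y + (l%:~R + 1).
  by rewrite -(intrD _ l 1) -iter_L1Dz//; apply: Fk; rewrite intrD; lra.
by rewrite ler_norml; apply/andP; split; lra.
Qed.

Lemma rotation_number_of_periodic (R : realType) (F : R -> R) (n : nat) (xi : R)
    (m : int) :
  L1 F -> {homo F : x y / x <= y} -> (0 < n)%N ->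
  iter n F xi = xi + m%:~R -> is_rotation_number F (m%:~R / n%:R).
Proof.
move=> FL Fnd n0 Fnxi x.
have n0R : n%:R != 0 :> R by rewrite pnatr_eq0 -lt0n.
pose u k := iter k F xi - xi - k%:R * (m%:~R / n%:R).
have un k : u (n + k)%N = u k.
  rewrite /u addnC iterD Fnxi iter_L1Dz// natrD mulrDl.
  by rewrite [n%:R * _]mulrC divfK//; ring.
have [C uC] := periodic_bounded n0 un.
pose v k := iter k F x - x - k%:R * (m%:~R / n%:R).
have vC k : `|v k| <= 1 + C.
  have -> : v k = (iter k F x - x) - (iter k F xi - xi) + u k by rewrite /v /u; ring.
  by apply: le_trans (ler_normD _ _) _; rewrite lerD// L1_drift_bound.
have v0 := bounded_div_cvg0 vC.
pose rho : R := m%:~R / n%:R.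
have : rho + v k / k%:R @[k --> \oo] --> rho + 0.
  by apply: cvgD => //; exact: cvg_cst.
rewrite addr0; apply: cvg_trans; apply: near_eq_cvg.
near=> k.
have k0 : k%:R != 0 :> R.
  by rewrite pnatr_eq0 -lt0n; near: k; exact: nbhs_infty_gt.
by rewrite /v /rho; field; apply/andP.
Unshelve. all: by end_near.
Qed.

(** * Constant sections *)

Lemma constant_on_lt1 (R : realType) (F : R -> R) (a b c : R) :
  L1 F -> a < b -> (forall x, a <= x <= b -> F x = c) -> b - a < 1.
Proof.
move=> FL ab Fc; rewrite ltNge; apply/negP => ba.
have Fa : F a = c by apply: Fc; lra.
have : F (a + 1) = c by apply: Fc; lra.
by rewrite FL.2 Fa; lra.
Qed.

Theorem proposition3p1 (R : realType) (F : R -> R) (K : set R) (n : nat)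
  (F_L1 : L1 F)
  (F_nondecreasing : {homo F : x y / x <= y})
  (K_section : constant_section F K)
  (n_gt0 : (0 < n)%N)
  (n_meets : meets_translates F K n)
  (n_minimal : forall k : nat, (0 < k < n)%N -> ~ meets_translates F K k) :
  exists (xi : R) (m : int),
    [/\ iter n F @` K = [set xi],
        [set xi] `<=` translate K m,
        m = Num.floor (xi - inf K),
        periodic_point_mod1 F n xi &
        is_rotation_number F (m%:~R / n%:R)].
Proof.
move: K_section => [[a [b [ab KE]]] [c Kc]].
have Ka : K a by rewrite KE /= in_itv /= lexx ltW.
have iterK k x y : (0 < k)%N -> K x -> K y -> iter k F x = iter k F y.
  by case: k => // k _ Kx Ky; rewrite !iterSr !Kc.
have [_ [[x0 Kx0 <-] [m _ [y Ky yE]]]] := n_meets.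
have FnK x : K x -> iter n F x = y + m%:~R.
  by move=> Kx; rewrite (iterK n x x0)// yE.
have Fn : iter n F (y + m%:~R) = y + m%:~R + m%:~R.
  by rewrite iter_L1Dz// (FnK y).
exists (y + m%:~R), m; split.
- apply/seteqP; split => [_ [x Kx <-] /=|_ /= ->]; first exact: FnK.
  by exists a => //; exact: FnK.
- by move=> _ ->; exists y.
- have /andP[ay yb] : a <= y <= b by move: Ky; rewrite KE /= in_itv.
  have ba1 : b - a < 1.
    by apply: (@constant_on_lt1 _ F a b c) => // x xab; apply: Kc; rewrite KE /= in_itv.
  have -> : inf K = a by rewrite KE inf_itv// bnd_simp ltW.
  by apply/esym/floor_def; rewrite intrD; lra.
- apply: (@periodic_point_mod1_of_iter _ _ _ _ m) => // k l kn.
  rewrite iter_L1Dz// => Fky; apply: (n_minimal k kn).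
  exists (iter k F y); split; first by exists y.
  by exists l => //; exists y => //; lra.
- exact: rotation_number_of_periodic Fn.
Qed.
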